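(* Let $K$ be a field, $d\ge1$, and let $T\subsetneq\mathcal{T}_d$ be a triangular region (i.e. $T=T_d(I)$ for a monomial ideal $I\subset K[x,y,z]$). Then $T$ has a reduction to unit punctures. Furthermore, $Z(T)$ has maximal rank if and only if $Z(\hat T)$ has maximal rank for some (hence any) reduction $\hat T$ of $T$ to unit punctures.
   Context: For $d\ge 1$, $\mathcal{T}_d$ is the equilateral triangle of side length $d$ subdivided into unit triangles, its downward-pointing unit triangles labelled by the monomials of degree $d-2$ and its upward-pointing unit triangles by the monomials of degree $d-1$ in $x,y,z$, with $x^{d-1}$ at the top, $y^{d-1}$ at the bottom-left, $z^{d-1}$ at the bottom-right; a downward triangle $n$ and an upward triangle $m$ share an edge iff $m\in\{xn,yn,zn\}$. $T_d(I)$ is the set of unit triangles whose label is not in $I$. $Z(T)$ is the zero-one matrix over $K$ with rows indexed by the downward-pointing and columns by the upward-pointing triangles of $T$, with entry $1$ iff the triangles share an edge. Let $J(T)$ be the largest ideal generated by monomials of degree at most $d-1$ with $T=T_d(J(T))$. The punctures of $T$ correspond to the minimal generators of $J(T)$: the puncture of $g$ is the upward-pointing triangle of all unit triangles with labels divisible by $g$, of side length $d-\deg g$. A unit puncture is one of side length $1$. Reduction to unit punctures: suppose $T$ has a puncture of side length at least two. Among the bottom rows of the punctures of side length at least two, consider the row closest to the bottom of $\mathcal{T}_d$ (i.e. the set of unit triangles whose labels have $x$-exponent $i$, where $i$ is the least $x$-exponent among the minimal generators of $J(T)$ of degree at most $d-2$). In this row pick a maximal strip $S$, i.e. a maximal sequence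 of consecutively adjacent unit triangles none of which belongs to $T$, containing at least one downward-pointing triangle, and pick any upward-pointing unit triangle $P$ in $S$. Replace $T$ by $T\cup(S\setminus\{P\})$, which is again a triangular region. Instead of a row one may also use a maximal strip parallel and closest to one of the other two sides of $\mathcal{T}_d$ (i.e. interchange the role of $x$ with that of $y$ or $z$). A region $\hat T\supseteq T$ obtained by repeating this procedure until all punctures are unit punctures is called a reduction of $T$ to unit punctures. *)

(* Defs.v *)
From HB Require Import structures.
From Stdlib Require Export Relation_Operators.
From mathcomp Require Export all_boot all_order all_algebra mpoly.

Set Implicit Arguments.
Unset Strict Implicit.
Unset Printing Implicit Defensive.

Import GRing.Theory.
Local Open Scope ring_scope.

(* K[x,y,z] is {mpoly K[3]}, with x, y, z the variables of index 0, 1, 2.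
   An ideal is given by its membership predicate, so that no decidability is
   required of it. *)

Section Ideals.
Variable K : fieldType.
Implicit Types (G : 'X_{1..3} -> Prop) (I J : {mpoly K[3]} -> Prop).

Definition ideal_gen G (p : {mpoly K[3]}) : Prop :=
  exists2 s : seq ({mpoly K[3]} * 'X_{1..3}),
    (forall c, c \in s -> G c.2) & p = \sum_(c <- s) c.1 * 'X_[c.2].

Definition generated_by I G : Prop := forall p, I p <-> ideal_gen G p.

Definition monomial_ideal I : Prop := exists G, generated_by I G.

Definition monomial_ideal_deg_lt (d : nat) I : Prop :=
  exists2 G, (forall g, G g -> (mdeg g < d)%N) & generated_by I G.

Definition minimal_generator J (g : 'X_{1..3}) : Prop :=
  J 'X_[g] /\ forall h : 'X_{1..3}, J 'X_[h] -> (h <= g)%MM -> h = g.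

End Ideals.

(* A unit triangle of the big triangle of side length d is identified with its
   label: degree d - 1 for an upward-pointing one, d - 2 for a downward-pointing
   one.  The degrees are compared without subtraction, so for d = 1 there is one
   upward-pointing and no downward-pointing triangle. *)
Definition unit_triangle (d : nat) : finType :=
  {m : 'X_{1..3 < d} | (d <= (mdeg m).+2)%N}.

Section Triangles.
Variable d : nat.
Implicit Types (t u n m : unit_triangle d) (T S : {set unit_triangle d}).

Definition label t : 'X_{1..3} := val (val t).

Definition upward t : bool := (mdeg (label t)).+1 == d.
Definition downward t : bool := (mdeg (label t)).+2 == d.

Definition share_edge n m : bool :=
  [&& downward n, upward m & [exists v : 'I_3, label m == (label n + U_(v))%MM]].

Definition adjacent t u : bool := share_edge t u || share_edge u t.

Definition downs T : {set unit_triangle d} := [set t in T | downward t].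
Definition ups T : {set unit_triangle d} := [set t in T | upward t].

(* The row of index i in direction v consists of the triangles whose labels have
   exponent i in the variable v; direction x gives the horizontal rows, counted
   from the bottom. *)
Definition strip T (v : 'I_3) (i : nat) S : Prop :=
  exists s : seq (unit_triangle d),
    [/\ S = [set t in s], uniq s, sorted adjacent s
      & forall t, t \in s -> label t v = i /\ t \notin T].

Definition maximal_strip T (v : 'I_3) (i : nat) S : Prop :=
  strip T v i S /\ forall S', strip T v i S' -> S \subset S' -> S' = S.

Definition puncture_side (g : 'X_{1..3}) : nat := (d - mdeg g)%N.

Variable K : fieldType.
Implicit Types I J : {mpoly K[3]} -> Prop.

(* T = T_d(I) *)
Definition region_of I T : Prop := forall t, t \in T <-> ~ I 'X_[label t].

Definition triangular_region T : Prop :=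
  exists2 I, monomial_ideal I & region_of I T.

(* J = J(T) *)
Definition largest_ideal T J : Prop :=
  [/\ monomial_ideal_deg_lt d J, region_of J T
    & forall J', monomial_ideal_deg_lt d J' -> region_of J' T ->
        forall p, J' p -> J p].

(* g generates a large puncture whose bottom row, in direction v, is closest to
   the corresponding side of the big triangle. *)
Definition lowest_large_puncture J (v : 'I_3) (g : 'X_{1..3}) : Prop :=
  [/\ minimal_generator J g, (2 <= puncture_side g)%N
    & forall h, minimal_generator J h -> (2 <= puncture_side h)%N ->
        (g v <= h v)%N].

Definition reduction_step T T' : Prop :=
  exists J v g S P,
    [/\ largest_ideal T J, lowest_large_puncture J v g,
        maximal_strip T v (g v) S /\ (exists2 n, n \in S & downward n),
        (P \in S) && upward P
      & T' = T :|: (S :\ P)].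

Definition only_unit_punctures T : Prop :=
  exists2 J, largest_ideal T J
    & forall g, minimal_generator J g -> puncture_side g = 1%N.

Definition reduction_to_unit_punctures T That : Prop :=
  clos_refl_trans_1n _ reduction_step T That /\ only_unit_punctures That.

Definition Zmx T : 'M[K]_(#|downs T|, #|ups T|) :=
  \matrix_(i < #|downs T|, j < #|ups T|)
    (share_edge (enum_val i) (enum_val j))%:R.

Definition Z_maximal_rank T : Prop :=
  \rank (Zmx T) = minn #|downs T| #|ups T|.

End Triangles.

(* Main.v *)
(* Let S be a maximal strip in a row, with k downward triangles.  It is a path that
   starts and ends with upward triangles, so it has k + 1 of these, and filling S except
   for one upward triangle P adds k rows and k columns to Z(T).  If T is triangular, then
   a downward triangle of S has exactly two neighbors in S and its third neighbor is still
   missing after filling.  A column kernel vector of the new matrix therefore takes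
   opposite values on consecutive upward triangles of S; being zero at P, it vanishes on S.
   So the column nullity is unchanged, the rank and both dimensions grow by k, and maximal
   rank is preserved in both directions. *)
Require Import Defs.
From Stdlib Require Import Classical.
From mathcomp Require Import zify.

Set Implicit Arguments.
Unset Strict Implicit.
Unset Printing Implicit Defensive.

Import GRing.Theory.
Local Open Scope ring_scope.

(** * Monomials in monomial ideals, and minimal generators *)

Section Ideals.
Variable K : fieldType.
Implicit Types (G : 'X_{1..3} -> Prop) (J : {mpoly K[3]} -> Prop).

Lemma dvdm_subK (g h : 'X_{1..3}) : (g <= h)%MM -> (g + (h - g))%MM = h.
Proof. by move=> le_gh; rewrite addmC submK. Qed.

(** Each summand [c.1 * 'X_[c.2]] is supported on multiples of [c.2], so if no generator divides
    [g], every combination has coefficient zero at [g]. *)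
Lemma ideal_gen_monomial G (g : 'X_{1..3}) :
  ideal_gen G ('X_[g] : {mpoly K[3]}) <-> exists2 h, G h & (h <= g)%MM.
Proof.
split=> [[s Gs Eg]|[h Gh le_hg]]; last first.
  exists [:: ('X_[g - h], h)] => [c|]; first by rewrite inE => /eqP->.
  by rewrite big_seq1 /= -mpolyXD submK.
apply: NNPP => nG.
have: ('X_[g] : {mpoly K[3]})@_g = 0.
  rewrite {1}Eg raddf_sum big_seq big1 //= => c cs.
  apply/eqP; apply: contraT; rewrite -mcoeff_msupp.
  rewrite (perm_mem (msuppMX _ _)) => /mapP[m _ Em].
  by case: nG; exists c.2; [exact: Gs | rewrite Em lem_addr].
by rewrite mcoeffX eqxx => /eqP; rewrite oner_eq0.
Qed.

Lemma monomial_ideal_mul J (g h : 'X_{1..3}) :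
  monomial_ideal J -> (g <= h)%MM -> J 'X_[g] -> J 'X_[h].
Proof.
case=> G JG le_gh /JG/ideal_gen_monomial[k Gk le_kg].
by apply/JG/ideal_gen_monomial; exists k => //; apply: lepm_trans le_gh.
Qed.

Lemma monomial_ideal_deg_ltW d J : monomial_ideal_deg_lt d J -> monomial_ideal J.
Proof. by case=> G _ JG; exists G. Qed.

(** By minimality [g] is itself one of the generators of degree below [d]. Hence punctures have
    positive side, and one whose side is not 1 is large. *)
Lemma minimal_generator_mdeg d J g :
  monomial_ideal_deg_lt d J -> minimal_generator J g -> (mdeg g < d)%N.
Proof.
case=> G Gd JG [/JG/ideal_gen_monomial[h Gh le_hg] min_g].
rewrite -(min_g h) //; first exact: Gd.
by apply/JG/ideal_gen_monomial; exists h; rewrite ?lepm_refl.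
Qed.

Lemma lepm_mdeg (g h : 'X_{1..3}) : (g <= h)%MM -> (mdeg g <= mdeg h)%N.
Proof. by move=> le_gh; rewrite -(dvdm_subK le_gh) mdegD leq_addr. Qed.

Lemma exists_minimal_generator J g :
  J 'X_[g] -> exists2 h, minimal_generator J h & (h <= g)%MM.
Proof.
elim: {g}(mdeg g).+1 {-2}g (ltnSn (mdeg g)) => // n IHn g le_gn Jg.
case: (classic (minimal_generator J g)) => [|nmin].
  by exists g; rewrite ?lepm_refl.
have [h [Jh le_hg ne_hg]]: exists h, [/\ J 'X_[h], (h <= g)%MM & h <> g].
  by apply: NNPP => nex; case: nmin; split=> // h Jh le_hg;
    apply: NNPP => ne; case: nex; exists h.
have lt_hg: (mdeg h < mdeg g)%N.
  rewrite -(dvdm_subK le_hg) mdegD -[X in (X < _)%N]addn0 ltn_add2l lt0n.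
  apply/eqP => /eqP; rewrite mdeg_eq0 => /eqP d0; apply: ne_hg.
  by rewrite -(dvdm_subK le_hg) d0 addm0.
have [k min_k le_kh] := IHn h (leq_trans lt_hg le_gn) Jh.
by exists k => //; apply: lepm_trans le_hg.
Qed.

End Ideals.

(** * Unit triangles, their adjacency, and maximal strips *)

Section Triangles.
Variable d : nat.
Implicit Types (a b e t u n m : unit_triangle d) (T S : {set unit_triangle d}).
Implicit Types (v w : 'I_3) (i : nat).

Lemma label_inj : injective (@label d).
Proof. by move=> t u /val_inj/val_inj. Qed.

Lemma mdeg_label_lt t : (mdeg (label t) < d)%N.
Proof. exact: (valP (val t)). Qed.

Lemma mdeg_label_ge t : (d <= (mdeg (label t)).+2)%N.
Proof. exact: (valP t). Qed.

Lemma exists_label (g : 'X_{1..3}) :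
  (mdeg g < d <= (mdeg g).+2)%N -> exists t : unit_triangle d, label t = g.
Proof.
case/andP=> g_lt g_ge.
by exists (Sub (Sub g g_lt : 'X_{1..3 < d}) g_ge : unit_triangle d).
Qed.

Lemma upwardN t : upward t = ~~ downward t.
Proof.
rewrite /upward /downward.
by have := mdeg_label_lt t; have := mdeg_label_ge t; lia.
Qed.

Lemma share_edgeP n m :
  reflect (exists2 w, downward n & label m = (label n + U_(w))%MM) (share_edge n m).
Proof.
apply: (iffP and3P) => [[dn _ /existsP[w /eqP Em]]|[w dn Em]]; first by exists w.
split=> //; last by apply/existsP; exists w; rewrite Em.
by move: dn; rewrite /downward /upward Em mdegD mdeg1 addn1.
Qed.

Lemma share_edge_down n m : share_edge n m -> downward n.
Proof. by case/and3P. Qed.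

Lemma share_edge_up n m : share_edge n m -> upward m.
Proof. by case/and3P. Qed.

Lemma adjacent_sym : ssrbool.symmetric (@adjacent d).
Proof. by move=> t u; rewrite /adjacent orbC. Qed.

Lemma adjacent_down n m : downward n -> adjacent n m = share_edge n m.
Proof.
by move=> dn; rewrite /adjacent orb_idr // => /share_edge_up; rewrite upwardN dn.
Qed.

Lemma exists_raise n w :
  downward n -> exists m, share_edge n m /\ label m = (label n + U_(w))%MM.
Proof.
move=> dn; have [|m Em] := @exists_label (label n + U_(w))%MM.
  by move: dn; rewrite /downward mdegD mdeg1; lia.
by exists m; split=> //; apply/share_edgeP; exists w.
Qed.

(* Meaningful for downward n only: otherwise x_w n is not a label and the value is n. *)
Definition raise w n : unit_triangle d :=
  odflt n [pick m | label m == (label n + U_(w))%MM].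

Lemma label_raise w n : downward n -> label (raise w n) = (label n + U_(w))%MM.
Proof.
move=> dn; rewrite /raise; case: pickP => [m /eqP //|none].
by have [m [_ Em]] := exists_raise w dn; have := none m; rewrite Em eqxx.
Qed.

Lemma raise_share_edge w n : downward n -> share_edge n (raise w n).
Proof. by move=> dn; apply/share_edgeP; exists w; rewrite ?label_raise. Qed.

Lemma raise_up w n : downward n -> upward (raise w n).
Proof. by move/(raise_share_edge w)/share_edge_up. Qed.

Lemma share_edge_raise n m : share_edge n m -> exists w, m = raise w n.
Proof.
by case/share_edgeP=> w dn Em; exists w; apply: label_inj; rewrite label_raise.
Qed.

Lemma other_directions v : exists w1 w2,
  [/\ w1 != v, w2 != v, w1 != w2 & forall w, [|| w == v, w == w1 | w == w2]].
Proof.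
have E w : [|| w == @Ordinal 3 0 isT, w == @Ordinal 3 1 isT | w == @Ordinal 3 2 isT].
  by case: w => [[|[|[|]]]].
by case/or3P: (E v) => /eqP->;
  [exists (@Ordinal 3 1 isT), (@Ordinal 3 2 isT)
  |exists (@Ordinal 3 0 isT), (@Ordinal 3 2 isT)
  |exists (@Ordinal 3 0 isT), (@Ordinal 3 1 isT)];
  split=> // w; move: (E w) => /or3P[] ->; rewrite ?orbT.
Qed.

(* For a set of unit triangles this amounts to being T_d(I) for a monomial ideal I. *)
Definition triangle_closed T : Prop :=
  forall n m, share_edge n m -> m \in T -> n \in T.

Section Strips.
Variables (T S : {set unit_triangle d}) (v : 'I_3) (i : nat).

Lemma strip_row t : strip T v i S -> t \in S -> label t v = i /\ t \notin T.
Proof. by case=> s [-> _ _ row]; rewrite inE => /row. Qed.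

(** A strip is a path and adjacency is symmetric, so [Q] spreads from [a] both ways. In the
    induction, [Q] at the first entry is equivalent to [Q] at the second. *)
Lemma strip_connected (Q : unit_triangle d -> Prop) :
  strip T v i S ->
  (forall a b, a \in S -> b \in S -> adjacent a b -> Q a -> Q b) ->
  forall a b, a \in S -> b \in S -> Q a -> Q b.
Proof.
case=> s [-> _ srt _] cl a b; rewrite !inE => a_s b_s Qa.
have {}cl x y: x \in s -> y \in s -> adjacent x y -> Q x -> Q y.
  by move=> xs ys; apply: cl; rewrite inE.
elim: s srt a b a_s b_s Qa cl => // x s IHs /= srt a b a_s b_s Qa cl.
have hd_s y: y \in s -> Q x <-> Q (head x s).
  case: (s) srt cl => //= z r /andP[xz _] cl _.
  by split; apply: cl; rewrite ?inE ?eqxx ?orbT // adjacent_sym.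
have IH y z: y \in s -> z \in s -> Q y -> Q z.
  move=> ys zs Qy; apply: (IHs (path_sorted srt) y z) => // p q ps qs.
  by apply: cl; rewrite inE ?ps ?qs orbT.
have h_in y: y \in s -> head x s \in s by case: (s) => //= z r _; rewrite inE eqxx.
move: a_s b_s; rewrite !inE.
case/predU1P=> [ax|a_s]; case/predU1P=> [bx|b_s]; subst=> //.
- by apply: (IH (head x s)); rewrite ?(h_in b) //; apply/(hd_s b).
- by apply/(hd_s a) => //; apply: (IH a) => //; apply: (h_in a).
- exact: (IH a).
Qed.

(** Staying in the row rules out direction [v], so a neighbor of [t] comes from one of the two other
    variables: by multiplication if [t] is downward, by division if it is upward. *)
Lemma row_neighbors a b c t :
  label a v = label t v -> label b v = label t v -> label c v = label t v ->
  adjacent a t -> adjacent b t -> adjacent c t -> a != b -> c = a \/ c = b.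
Proof.
have [w1 [w2 [n1 n2 _ ws]]] := other_directions v.
have dir w: (w != v) = (w == w1) || (w == w2).
  have := ws w; case: eqVneq => [->|_ /= -> //] _.
  by rewrite eq_sym (negPf n1) eq_sym (negPf n2).
suff [x [y xy]]: exists x y, forall e,
    label e v = label t v -> adjacent e t -> e = x \/ e = y.
  move=> ra rb rc Aa Ab Ac.
  case: (xy a ra Aa) => ->; case: (xy b rb Ab) => ->;
  case: (xy c rc Ac) => ->; rewrite ?eqxx //; tauto.
case dt: (downward t).
  exists (raise w1 t), (raise w2 t) => e re; rewrite adjacent_sym adjacent_down //.
  case/share_edge_raise=> w Ee.
  have: w != v.
    apply/eqP => wv; move: re; rewrite Ee label_raise // mnmDE mnm1E wv eqxx addn1.
    by move/esym/n_Sn.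
  by rewrite Ee dir => /orP[]/eqP->; [left|right].
have key e: label e v = label t v -> adjacent e t ->
    exists2 w, (w == w1) || (w == w2) & label e = (label t - U_(w))%MM.
  move=> re; rewrite /adjacent => /orP[/share_edgeP[w de Et]|/share_edge_down]; last first.
    by rewrite dt.
  exists w; last by rewrite Et addmK.
  rewrite -dir; apply/eqP => wv; move: re.
  by rewrite Et mnmDE mnm1E wv eqxx addn1 => /n_Sn.
(* Only uniqueness matters: if no triangle has this label, the claim is vacuous and [t] is a
   dummy. *)
have pickl w: exists x, forall e, label e = (label t - U_(w))%MM -> e = x.
  case: (classic (exists x : unit_triangle d, label x = (label t - U_(w))%MM)).
    by case=> x Ex; exists x => e Ee; apply: label_inj; rewrite Ee.
  by move=> none; exists t => e Ee; case: none; exists e.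
have [x Ex] := pickl w1; have [y Ey] := pickl w2; exists x, y => e re /(key e re)[w].
by case/orP=> /eqP-> Ee; [left; apply: Ex | right; apply: Ey].
Qed.

(** If [b] were outside [S], then [a] could not be an end of the path, since attaching [b] there
    would contradict maximality. Nor could it be interior, since it would have three neighbors in
    its row. *)
Lemma maximal_strip_closed a b :
  maximal_strip T v i S -> a \in S -> label b v = i -> b \notin T ->
  adjacent a b -> b \in S.
Proof.
move=> [[s [ES us srt row]] maxS] aS bi bT Aab; apply: contraT => bS.
have bs: b \notin s by move: bS; rewrite ES inE.
have as_: a \in s by move: aS; rewrite ES inE.
have absurd s' : perm_eq s' (b :: s) -> sorted (@adjacent d) s' -> False.
  move=> ps' srt'; have mem' := perm_mem ps'.
  have: [set t in s'] = S.
    apply: maxS; last by rewrite ES; apply/subsetP=> t; rewrite !inE mem' inE orbC => ->.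
    exists s'; split=> // [|t]; first by rewrite (perm_uniq ps') /= bs us.
    by rewrite mem' inE => /predU1P[->//|/row].
  by move/setP/(_ b); rewrite (negPf bS) inE mem' inE eqxx.
case/splitPr: as_ us srt row ES bs absurd => s1 s2 us srt row _ bs absurd.
exfalso; case: s2 us srt row bs absurd => [|c s2] us srt row bs absurd.
  apply: (absurd (rcons (s1 ++ [:: a]) b)); first by rewrite perm_rcons.
  by case: (s1) srt => [|x r] /=; rewrite ?Aab // rcons_path last_cat /= Aab => ->.
case/lastP: s1 us srt row bs absurd => [|s1 e] us srt row bs absurd.
  by apply: (absurd [:: b, a, c & s2]) => //=; rewrite adjacent_sym Aab.
have ra: label a v = i by apply: (proj1 (row a _)); rewrite mem_cat inE eqxx orbT.
have rc: label c v = i by apply: (proj1 (row c _)); rewrite mem_cat !inE eqxx !orbT.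
have re: label e v = i by apply: (proj1 (row e _)); rewrite mem_cat mem_rcons inE eqxx.
have [Aea Aac]: adjacent e a /\ adjacent a c.
  move: srt; case: (s1) => [|x r] /=; first by case/and3P.
  by rewrite cat_path rcons_path last_rcons /= => /andP[/andP[_ _] /and3P[]].
have ne_ec: e != c.
  move: us; rewrite cat_uniq => /and3P[_ /hasPn/(_ c)]; rewrite !inE eqxx orbT mem_rcons inE.
  by move=> /(_ isT); rewrite negb_or eq_sym => /andP[].
have [] := @row_neighbors e c b a; rewrite ?ra ?rc ?re //; first by rewrite adjacent_sym.
- by rewrite adjacent_sym.
- by move=> Eb; move: bs; rewrite Eb mem_cat mem_rcons inE eqxx.
- by move=> Eb; move: bs; rewrite Eb mem_cat !inE eqxx !orbT.
Qed.

End Strips.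

Lemma exists_maximal_strip T v i S0 :
  strip T v i S0 -> exists2 S, maximal_strip T v i S & S0 \subset S.
Proof.
elim: {S0}#|~: S0|.+1 {-2}S0 (ltnSn #|~: S0|) => // k IHk S0 le_k st.
case: (classic (maximal_strip T v i S0)) => [|nmax]; first by exists S0.
have [S1 [st1 sub ne]]: exists S1, [/\ strip T v i S1, S0 \subset S1 & S1 <> S0].
  by apply: NNPP => nex; case: nmax; split=> // S1 st1 sub;
    apply: NNPP => ne; case: nex; exists S1.
have [|S max_S sub1] := IHk S1 _ st1; last by exists S => //; apply: subset_trans sub1.
apply: leq_trans (_ : #|~: S0| <= k)%N => //; apply: proper_card.
rewrite properE !setCS sub; apply/negP => sub'.
by apply: ne; apply/eqP; rewrite eqEsubset sub' sub.
Qed.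

End Triangles.

(** * The rank of a matrix enlarged by rows and columns *)

Section RankExtension.
Variables (K : fieldType) (X : finType) (M : X -> X -> K).
Implicit Types A B : {set X}.

(** One entry function on an ambient type serves all index sets, so that matrices over nested sets
    can be compared. *)
Definition submx_on A B : 'M[K]_(#|A|, #|B|) :=
  \matrix_(i < #|A|, j < #|B|) M (enum_val i) (enum_val j).

Lemma sum_enum_val B (F : X -> K) :
  \sum_(j < #|B|) F (enum_val j) = \sum_(x in B) F x.
Proof. by rewrite [RHS]big_enum_val. Qed.

Lemma mul_row_submxT A B (u : 'rV[K]_#|B|) (f : X -> K) i :
  (forall j, u 0 j = f (enum_val j)) ->
  (u *m (submx_on A B)^T) 0 i = \sum_(x in B) M (enum_val i) x * f x.
Proof.
move=> uf; rewrite mxE -sum_enum_val; apply: eq_bigr => j _.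
by rewrite !mxE uf mulrC.
Qed.

(** With vectors turned into functions on all of [X], restriction and extension between [B] and [B']
    work with the same [f]. *)
Lemma row_as_fun B (u : 'rV[K]_#|B|) : exists f, forall j, u 0 j = f (enum_val j).
Proof.
exists (fun x => \sum_j (enum_val j == x)%:R * u 0 j) => j.
rewrite (bigD1 j) //= eqxx mul1r big1 ?addr0 // => k kj.
by rewrite (inj_eq enum_val_inj) (negPf kj) mul0r.
Qed.

(* The column kernels of the two matrices correspond under extension by zero,
   so the two column nullities agree. *)
Lemma mxrank_submx_extend A A' B B' :
    A \subset A' -> B \subset B' ->
    (forall n m, n \in A' :\: A -> m \in B -> M n m = 0) ->
    (forall f : X -> K,
       (forall n, n \in A' :\: A -> \sum_(m in B') M n m * f m = 0) ->
       forall m, m \in B' :\: B -> f m = 0) ->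
  (\rank (submx_on A' B') + #|B| = \rank (submx_on A B) + #|B'|)%N.
Proof.
move=> sAA' sBB' M0 inj.
(* [E] is the inclusion of [B] in [B']: multiplying by it extends a row vector by zero. Its rows are
   orthonormal, so it preserves ranks. *)
pose E : 'M[K]_(#|B|, #|B'|) := \matrix_(i, j) (enum_val i == enum_val j :> X)%:R.
have uE (u : 'rV[K]_#|B|) f : (forall j, u 0 j = f (enum_val j)) ->
    forall j, (u *m E) 0 j = if enum_val j \in B then f (enum_val j) else 0.
  move=> uf j; rewrite mxE.
  under eq_bigr => k _ do rewrite mxE uf.
  rewrite (sum_enum_val B (fun x => f x * (x == enum_val j)%:R)).
  case: ifP => [jB|jB]; last first.
    rewrite big1 // => x xB; case: eqP => [Ex|_]; last by rewrite mulr0.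
    by rewrite -Ex xB in jB.
  rewrite (bigD1 (enum_val j)) //= eqxx mulr1 big1 ?addr0 // => x /andP[_ /negPf->].
  by rewrite mulr0.
have EET : E *m E^T = 1%:M.
  apply/matrixP => i j; rewrite !mxE.
  under eq_bigr => k _ do rewrite !mxE.
  rewrite (sum_enum_val B' (fun x => (enum_val i == x)%:R * (enum_val j == x)%:R)).
  have iB : enum_val i \in B' by apply: (subsetP sBB'); apply: enum_valP.
  rewrite (bigD1 (enum_val i)) //= eqxx mul1r (inj_eq enum_val_inj) big1 ?addr0.
    by rewrite eq_sym.
  by move=> x /andP[_]; rewrite eq_sym => /negPf->; rewrite mul0r.
have freeE : row_free E by apply/row_freeP; exists E^T.
have ker_eq : (kermx (submx_on A' B')^T :=: kermx (submx_on A B)^T *m E)%MS.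
  apply/eqmxP/andP; split; apply/row_subP => r.
    (* A kernel vector of the large matrix vanishes on the new columns, so it is the extension of
       its restriction [u0]. *)
    set u := row r _; have [f uf] := row_as_fun u.
    have: u *m (submx_on A' B')^T = 0 by apply/sub_kermxP; apply: row_sub.
    move=> /rowP ker_u.
    have sum0 n : n \in A' -> \sum_(m in B') M n m * f m = 0.
      move=> nA; have := ker_u (enum_rank_in nA n).
      by rewrite (mul_row_submxT _ uf) enum_rankK_in // mxE.
    have f0 : forall m, m \in B' :\: B -> f m = 0.
      by apply: inj => n /setDP[nA _]; apply: sum0.
    pose u0 : 'rV[K]_#|B| := \row_j f (enum_val j).
    have u0f j : u0 0 j = f (enum_val j) by rewrite mxE.
    have -> : u = u0 *m E.
      apply/rowP => j; rewrite (uE _ _ u0f) uf; case: ifP => // jB.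
      by apply: f0; rewrite inE jB enum_valP.
    apply: submxMr; apply/sub_kermxP/rowP => i.
    rewrite (mul_row_submxT _ u0f) [RHS]mxE.
    have := sum0 _ (subsetP sAA' _ (enum_valP i)).
    rewrite (big_setID B) /= (setIidPr sBB') [X in _ + X]big1 ?addr0 // => m mB.
    by rewrite f0 ?mulr0.
  (* Conversely, a row of [A] gives the old sum on the extension by zero, and a new row is zero on
     [B]. *)
  rewrite row_mul; set u := row r _; have [f uf] := row_as_fun u.
  have: u *m (submx_on A B)^T = 0 by apply/sub_kermxP; apply: row_sub.
  move=> /rowP ker_u; apply/sub_kermxP/rowP => i; have uEf := uE _ _ uf.
  rewrite (mul_row_submxT i (f := fun x => if x \in B then f x else 0)) //.
  rewrite [RHS]mxE (big_setID B) /= (setIidPr sBB') [X in _ + X]big1 ?addr0; last first.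
    by move=> m /setDP[_ /negPf->]; rewrite mulr0.
  case iA : (enum_val i \in A).
    have := ker_u (enum_rank_in iA (enum_val i)).
    rewrite (mul_row_submxT _ uf) enum_rankK_in // mxE => sum0; rewrite -[RHS]sum0.
    by apply: eq_bigr => m ->.
  apply: big1 => m mB; rewrite M0 ?mul0r //.
  by rewrite inE iA enum_valP.
(* The nullities are truncated differences, so [lia] also needs that the ranks do not exceed the
   numbers of columns. *)
have := mxrankMfree (kermx (submx_on A B)^T) freeE; rewrite -ker_eq !mxrank_ker !mxrank_tr.
by have := rank_leq_col (submx_on A B); have := rank_leq_col (submx_on A' B'); lia.
Qed.

End RankExtension.

(** * Filling a maximal strip except for one upward triangle *)

Section FillStrip.
Variables (d : nat) (T S : {set unit_triangle d}) (v : 'I_3) (i : nat).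
Variables (n0 P : unit_triangle d).
Hypotheses (closedT : triangle_closed T) (maxS : maximal_strip T v i S).
Hypotheses (n0S : n0 \in S) (n0_down : downward n0) (PS : P \in S) (P_up : upward P).
Implicit Types (a b e t u n m : unit_triangle d) (w : 'I_3).

(** The neighbor stays in the row, and it lies outside [T] because [T] is closed and misses [n]. So
    a maximal strip cannot end at a downward triangle. *)
Lemma strip_raise w n : w != v -> n \in S -> downward n -> raise w n \in S.
Proof.
move=> wv nS dn; have [rn nT] := strip_row (proj1 maxS) nS.
have sh := raise_share_edge w dn.
apply: (maximal_strip_closed maxS nS).
- by rewrite label_raise // mnmDE mnm1E (negPf wv) addn0.
- by apply: contra nT; apply: closedT.
- by rewrite adjacent_down.
Qed.

Lemma strip_direction w n :
  n \in S -> downward n -> raise w n \in S -> w != v.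
Proof.
move=> /(strip_row (proj1 maxS))[rn _] dn /(strip_row (proj1 maxS))[rm _].
apply/eqP => wv; move: rm.
by rewrite label_raise // mnmDE mnm1E wv eqxx rn addn1 => /esym/n_Sn.
Qed.

(** The exponents of [v] and [w] and the common degree determine the remaining exponent. *)
Lemma upward_row_inj w t u :
  w != v -> upward t -> upward u -> label t v = label u v ->
  label t w = label u w -> t = u.
Proof.
move=> wv ut uu tv tw; apply: label_inj; apply/mnmP.
have [w1 [w2 [n1 n2 n12 ws]]] := other_directions v.
have [w' cover] : exists w', forall x, x != w' -> x = v \/ x = w.
  have := ws w; rewrite (negPf wv) /= => /orP[]/eqP->; [exists w2|exists w1] => x;
    case/or3P: (ws x) => /eqP->; rewrite ?eqxx //; tauto.
have eqx x : x != w' -> label t x = label u x by case/cover=> ->.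
move=> x; case: (eqVneq x w') => [->|/eqx //].
have: mdeg (label t) = mdeg (label u).
  by move: ut uu; rewrite /upward => /eqP et /eqP eu; apply: succn_inj; rewrite et.
rewrite !mdegE (bigD1 w') //= [RHS](bigD1 w') //=.
by rewrite (eq_bigr (fun x => label u x)) // => /addIn.
Qed.

(* For a direction w other than v, raising along w injects the downward triangles
   of S into the upward ones and misses only the one with least w-exponent. *)
Lemma card_ups_strip : #|ups S| = #|downs S|.+1.
Proof.
have [w1 [w2 [n1 n2 n12 ws]]] := other_directions v.
have upsS w n : w != v -> n \in downs S -> raise w n \in ups S.
  by rewrite !inE => wv /andP[nS dn]; rewrite strip_raise // raise_up.
have r0 : raise w1 n0 \in ups S by apply: upsS; rewrite // inE n0S.
have [m0 m0S m0min] : exists2 m0, m0 \in ups S &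
    forall u, u \in ups S -> (label m0 w1 <= label u w1)%N.
  by case: (arg_minnP (fun t => label t w1) r0) => m; exists m.
(* If [m0] were [raise w1 n], then [raise w2 n], also in [S], would have a smaller [w1]-exponent. *)
have m0N : m0 \notin raise w1 @: downs S.
  apply/imsetP => -[n nS Em0]; have := m0min _ (upsS w2 _ n2 nS).
  have dn : downward n by move: nS; rewrite inE => /andP[].
  by rewrite Em0 !label_raise // !mnmDE !mnm1E eqxx eq_sym (negPf n12) addn0 addn1 ltnn.
have -> : ups S = m0 |: raise w1 @: downs S.
  apply/setP => u; rewrite in_setU1; apply/idP/idP; last first.
    by case/predU1P=> [->//|/imsetP[n nS ->]]; apply: upsS.
  move=> uS; rewrite -[_ || _]negbK negb_or; apply/negP => /andP[/eqP um0 uN].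
  move: (uS) (m0S); rewrite !inE => /andP[uS' uu] /andP[m0S' um].
  have [ru _] := strip_row (proj1 maxS) uS'.
  have [rm _] := strip_row (proj1 maxS) m0S'.
  case: um0; apply: (upward_row_inj n1); rewrite ?ru ?rm //.
  apply/eqP; rewrite eqn_leq m0min // andbT.
  (* Walk from [u] to [m0]. The [w1]-exponent can drop below that of [u] only on passing from
     [raise w1 b] to [b] where [raise w1 b] has the exponent of [u]. Then [raise w1 b] is [u],
     against [uN]. *)
  apply: (strip_connected (Q := fun t => (label u w1 <= label t w1)%N)
            (proj1 maxS) _ uS') => // a b aS bS.
  rewrite /adjacent => /orP[/share_edgeP[w _ ->]|sh].
    by move=> le_ua; rewrite mnmDE (leq_trans le_ua) ?leq_addr.
  have db := share_edge_down sh; have [w Ea] := share_edge_raise sh; subst a.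
  have := strip_direction bS db aS; have := ws w.
  case: (w == v) => //= /orP[]/eqP Ew _; subst w; last first.
    by rewrite label_raise // mnmDE mnm1E eq_sym (negPf n12) addn0.
  rewrite leq_eqVlt => /predU1P[Eu|]; last first.
    by rewrite label_raise // mnmDE mnm1E eqxx addn1 ltnS.
  case/imsetP: uN; exists b; first by rewrite inE bS.
  apply: (upward_row_inj n1) => //; first exact: share_edge_up sh.
  by rewrite ru (proj1 (strip_row (proj1 maxS) aS)).
rewrite cardsU1 m0N card_in_imset // => n n'; rewrite !inE => /andP[_ dn] /andP[_ dn'].
by move/(congr1 (@label d)); rewrite !label_raise // => /addIm/label_inj.
Qed.

Let T' := T :|: (S :\ P).

Lemma strip_disjoint t : t \in S -> t \notin T.
Proof. by case/(strip_row (proj1 maxS)). Qed.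

Lemma downs_fill : downs T' = downs T :|: downs S.
Proof.
apply/setP => t; rewrite !inE; case: eqVneq => [->|_] //=; last by rewrite andb_orl.
by move: P_up; rewrite upwardN => /negPf->; rewrite !andbF.
Qed.

Lemma card_downs_fill : #|downs T'| = (#|downs T| + #|downs S|)%N.
Proof.
rewrite downs_fill cardsU disjoint_setI0 ?cards0 ?subn0 //.
apply/pred0P => t; rewrite /= !inE; apply/negP => /andP[/andP[tT _] /andP[tS _]].
by have := strip_disjoint tS; rewrite tT.
Qed.

Lemma ups_fill : ups T' = ups T :|: (ups S :\ P).
Proof. by apply/setP => t; rewrite !inE andb_orl andbA. Qed.

Lemma card_ups_fill : #|ups T'| = (#|ups T| + #|downs S|)%N.
Proof.
have := card_ups_strip; rewrite (cardsD1 P) inE PS P_up add1n => -[<-].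
rewrite ups_fill cardsU disjoint_setI0 ?cards0 ?subn0 //.
apply/pred0P => t; rewrite /= !inE; apply/negP => /andP[/andP[tT _] /and3P[_ tS _]].
by have := strip_disjoint tS; rewrite tT.
Qed.

Lemma mxrank_Zmx (K : fieldType) (U : {set unit_triangle d}) :
  \rank (Zmx K U)
  = \rank (submx_on (fun n m => (share_edge n m)%:R : K) (downs U) (ups U)).
Proof. by congr mxrank; apply/matrixP => k j; rewrite !mxE. Qed.

(* The third neighbor of n, raised along v, lies outside T and outside S. *)
Lemma sum_fill_neighbors (K : fieldType) (f : unit_triangle d -> K) w1 w2 n :
    w1 != w2 -> (forall w, [|| w == v, w == w1 | w == w2]) ->
    n \in S -> downward n ->
  let g t := if t \in T' then f t else 0 in
  \sum_(m in ups T') (share_edge n m)%:R * f m = g (raise w1 n) + g (raise w2 n).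
Proof.
move=> n12 ws nS dn g; have nT := strip_disjoint nS.
have ne : raise w2 n != raise w1 n.
  apply/eqP => /(congr1 (@label d)); rewrite !label_raise // => /addmI/eqP.
  by rewrite eq_mnm1 eq_sym (negPf n12).
have -> : \sum_(m in ups T') (share_edge n m)%:R * f m
        = \sum_m (share_edge n m)%:R * g m.
  rewrite big_mkcond /=; apply: eq_bigr => m _; rewrite /g [m \in ups T']inE.
  case: (m \in T') => /=; last by rewrite mulr0.
  case: ifP => // um; case sh: share_edge; last by rewrite mul0r.
  by rewrite (share_edge_up sh) in um.
rewrite (bigD1 (raise w1 n)) //= (bigD1 (raise w2 n)) //=.
rewrite !raise_share_edge // !mul1r big1 ?addr0 // => m /andP[m1 m2].
case sh: share_edge; rewrite ?mul0r // mul1r.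
have [w Em] := share_edge_raise sh; subst m.
have wv : w = v.
  case/or3P: (ws w) => /eqP // Ew; first by rewrite Ew eqxx in m1.
  by rewrite Ew eqxx in m2.
rewrite /g; case: ifP => //; rewrite !inE => /orP[mT|/andP[_ mS]].
  by rewrite (closedT sh mT) in nT.
by have := strip_direction nS dn mS; rewrite wv eqxx.
Qed.

(* A kernel vector vanishes at P, which lies outside T'; every downward triangle of S
   says that its two neighbors in S carry opposite values, so zero propagates. *)
Lemma mxrank_fill (K : fieldType) :
  (\rank (Zmx K T') + #|ups T| = \rank (Zmx K T) + #|ups T'|)%N.
Proof.
rewrite !mxrank_Zmx; apply: mxrank_submx_extend.
- by apply/subsetP => t; rewrite !inE => /andP[-> ->].
- by apply/subsetP => t; rewrite !inE => /andP[-> ->].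
- move=> n m; rewrite downs_fill !inE => /andP[/negPf nT /orP[|/andP[nS _]]].
    by rewrite nT.
  move=> /andP[mT _]; case sh: share_edge => //.
  by have := strip_disjoint nS; rewrite (closedT sh mT).
move=> f ker.
pose g t := if t \in T' then f t else 0.
have [w1 [w2 [n1 n2 n12 ws]]] := other_directions v.
have opp n : n \in S -> downward n -> g (raise w1 n) + g (raise w2 n) = 0.
  move=> nS dn; rewrite -sum_fill_neighbors //; apply: ker.
  by rewrite downs_fill !inE (negPf (strip_disjoint nS)) nS dn.
(* At a downward triangle, [Q] says that both neighbors in the strip carry zero, so the propagation
   runs along single adjacencies. *)
pose Q t := if upward t then g t = 0 else g (raise w1 t) = 0 /\ g (raise w2 t) = 0.
have QS t : t \in S -> Q t.
  move=> tS; apply: (strip_connected (Q := Q) (proj1 maxS) _ PS tS); last first.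
    by rewrite /Q P_up /g !inE eqxx /= orbF (negPf (strip_disjoint PS)).
  move=> a b aS bS /orP[]sh.
    have da := share_edge_down sh; have ub := share_edge_up sh.
    rewrite /Q ub upwardN da /=; have [w Eb] := share_edge_raise sh; subst b.
    have := strip_direction aS da bS; have := ws w.
    by case: (w == v) => //= /orP[]/eqP-> _ [].
  have db := share_edge_down sh; have ua := share_edge_up sh.
  rewrite /Q ua upwardN db /=; have [w Ea] := share_edge_raise sh; subst a.
  have := strip_direction bS db aS; have := ws w; have := opp b bS db.
  case: (w == v) => //= eq0 /orP[]/eqP-> _ g0; move: eq0; rewrite g0.
    by rewrite add0r.
  by rewrite addr0.
move=> m /setDP[]; rewrite ups_fill => /setUP[-> //|/setD1P[mP]].
rewrite inE => /andP[mS um] _; have := QS m mS.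
by rewrite /Q um /g in_setU in_setD1 mP mS orbT.
Qed.

(** Both dimensions grow by the number of downward triangles in [S], and by [mxrank_fill] so does
    the rank; the minimum shifts by the same amount. *)
Lemma Z_maximal_rank_fill (K : fieldType) :
  Z_maximal_rank K T <-> Z_maximal_rank K T'.
Proof.
have shift r r' p p' q q' k : p' = (p + k)%N -> q' = (q + k)%N ->
    (r' + p = r + p')%N -> (r = minn q p <-> r' = minn q' p').
  by lia.
exact: shift card_ups_fill card_downs_fill (mxrank_fill K).
Qed.

(** This is the measure for termination: [n0] gets filled, since it is downward and hence different
    from [P]. *)
Lemma card_compl_fill : (#|~: T'| < #|~: T|)%N.
Proof.
apply: proper_card; apply/properP; split.
  by apply/subsetP => t; rewrite !inE negb_or => /andP[].
exists n0; first by rewrite inE strip_disjoint.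
rewrite !inE n0S andbT negbK; apply/orP; right; apply/eqP => E.
by move: P_up; rewrite upwardN -E n0_down.
Qed.

(* If m in S equals n + U_(v), then n lies in the row below that of S, hence in T by the
   choice of S. *)
Lemma triangle_closed_fill :
  (forall t, downward t -> t \notin T -> (i <= label t v)%N) -> triangle_closed T'.
Proof.
move=> low n m sh; have dn := share_edge_down sh.
have nP : n != P by apply/eqP => E; move: P_up; rewrite upwardN -E dn.
rewrite !inE nP /= => /orP[mT|/andP[_ mS]]; first by rewrite (closedT sh mT).
case nT: (n \in T) => //=; have [rm _] := strip_row (proj1 maxS) mS.
apply: (maximal_strip_closed maxS mS); rewrite ?nT //; last first.
  by rewrite adjacent_sym adjacent_down.
apply/eqP; rewrite eqn_leq low ?nT // andbT -rm.
by case/share_edgeP: sh => w _ ->; rewrite mnmDE leq_addr.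
Qed.

End FillStrip.

(** * Existence of reductions and invariance of maximal rank *)

Section Reduction.
Variables (K : fieldType) (d : nat).
Implicit Types (T S : {set unit_triangle d}) (t n m : unit_triangle d).
Implicit Types (J : {mpoly K[3]} -> Prop) (g h : 'X_{1..3}).

Lemma region_closed J T : monomial_ideal J -> region_of J T -> triangle_closed T.
Proof.
move=> monJ regJ n m /share_edgeP[w _ Em] /regJ nJm; apply/regJ => Jn; apply: nJm.
by apply: monomial_ideal_mul Jn => //; rewrite Em lem_addr.
Qed.

Lemma region_notin J T t : region_of J T -> t \notin T -> J 'X_[label t].
Proof. by move=> regJ tT; apply: NNPP => /regJ; apply/negP. Qed.

(** Labels have degree [d - 2] or [d - 1], so their quotient has degree at most one: the triangles
    coincide or share an edge. *)
Lemma triangle_closed_le T t u :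
  triangle_closed T -> (label t <= label u)%MM -> u \in T -> t \in T.
Proof.
move=> closedT le_tu uT.
have Eu := dvdm_subK le_tu; have := congr1 (@mdeg 3) Eu; rewrite mdegD.
have := mdeg_label_lt u; have := mdeg_label_ge t; move: (label u - label t)%MM Eu.
move=> k Eu t_ge u_lt Edeg; have: (mdeg k <= 1)%N by lia.
rewrite leq_eqVlt => /orP[/mdeg1P[w /eqP Ek]|]; last first.
  rewrite ltnS leqn0 mdeg_eq0 => /eqP Ek; rewrite Ek addm0 in Eu.
  by rewrite (label_inj Eu).
apply: closedT uT; apply/share_edgeP; exists w; last by rewrite -Eu Ek.
by move: Edeg; rewrite Ek mdeg1 /downward; lia.
Qed.

Lemma exists_largest_ideal T : triangle_closed T -> exists J, largest_ideal T J.
Proof.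
move=> closedT.
(* The largest ideal is generated by all monomials of degree below [d] that divide no label in [T];
   any competing ideal has its generators among these. *)
pose G g := (mdeg g < d)%N /\ forall t, t \in T -> ~ (g <= label t)%MM.
exists (ideal_gen G); split; first by exists G => // g [].
  move=> t; split=> [tT /ideal_gen_monomial[g [_ gT]]|]; first exact: gT.
  move=> nJt; apply: contraT => tT; exfalso; apply/nJt/ideal_gen_monomial.
  exists (label t); last exact: lepm_refl.
  split=> [|u uT le_tu]; first exact: mdeg_label_lt.
  by move: tT; rewrite (triangle_closed_le closedT le_tu uT).
move=> J' lt_J' regJ' p; have monJ' := monomial_ideal_deg_ltW lt_J'.
case: lt_J' => G' G'd J'G' /J'G'[s sG' Ep]; exists s => // c /sG' G'c.
split=> [|t /regJ' nJ't le_ct]; first exact: G'd.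
apply: nJ't; apply: monomial_ideal_mul le_ct _ => //.
by apply/J'G'/ideal_gen_monomial; exists c.2; rewrite ?lepm_refl.
Qed.

Lemma reduction_step_props T T' : reduction_step K T T' ->
  [/\ triangle_closed T', (#|~: T'| < #|~: T|)%N
    & Z_maximal_rank K T <-> Z_maximal_rank K T'].
Proof.
case=> J [v [g [S [P [[ltJ regJ _] [_ _ low] [maxS [n nS dn]] /andP[PS uP] ->]]]]].
have monJ := monomial_ideal_deg_ltW ltJ; have closedT := region_closed monJ regJ.
split; last 1 first.
- exact: Z_maximal_rank_fill closedT maxS nS dn PS uP K.
- apply: (triangle_closed_fill closedT maxS uP) => t dt tT.
  (* The label of a missing downward triangle is divisible by a minimal generator of degree at most
     [d - 2], that is, of a large puncture. The choice of [g] then bounds the [v]-exponent from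
     below. *)
  have [h min_h le_ht] := exists_minimal_generator (region_notin regJ tT).
  apply: leq_trans (mnm_lepP le_ht v); apply: low => //.
  by move: dt (lepm_mdeg le_ht); rewrite /downward /puncture_side; lia.
- exact: card_compl_fill maxS nS dn uP.
Qed.

Lemma exists_lowest_large_puncture J v g :
  minimal_generator J g -> (2 <= puncture_side d g)%N ->
  exists h, lowest_large_puncture d J v h.
Proof.
elim: {g}(g v).+1 {-2}g (ltnSn (g v)) => // k IHk g le_gk min_g side_g.
case: (classic (lowest_large_puncture d J v g)) => [|nlow]; first by exists g.
have [h [min_h side_h lt_hg]]: exists h,
    [/\ minimal_generator J h, (2 <= puncture_side d h)%N & (h v < g v)%N].
  apply: NNPP => nex; apply: nlow; split=> // h min_h side_h.
  by rewrite leqNgt; apply/negP => lt_hg; apply: nex; exists h.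
exact: IHk (leq_trans lt_hg le_gk) min_h side_h.
Qed.

Lemma only_unit_or_step T : triangle_closed T ->
  only_unit_punctures K T \/ exists T', reduction_step K T T'.
Proof.
move=> closedT; have [J largeJ] := exists_largest_ideal closedT.
have [ltJ regJ _] := largeJ; have monJ := monomial_ideal_deg_ltW ltJ.
case: (classic (forall g, minimal_generator J g -> puncture_side d g = 1%N)).
  by move=> unit_J; left; exists J.
move=> not_unit; right.
have [g0 [min_g0 side_g0]]: exists g,
    minimal_generator J g /\ (2 <= puncture_side d g)%N.
  apply: NNPP => nex; apply: not_unit => g min_g.
  have := minimal_generator_mdeg ltJ min_g.
  case: (leqP 2 (puncture_side d g)) => [side_g|]; first by case: nex; exists g.
  by rewrite /puncture_side; lia.
pose v : 'I_3 := ord0.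
have [g low_g] := exists_lowest_large_puncture v min_g0 side_g0.
have [w [_ [wv _ _ _]]] := other_directions v; have [min_g side_g _] := low_g.
(* A power of a variable other than [v] brings the degree of [g] up to [d - 2] and keeps the
   [v]-exponent: this is a downward triangle in the bottom row of the puncture. *)
have [n En]: exists n, label n = (g + U_(w) *+ (d - 2 - mdeg g))%MM.
  by apply: exists_label; move: side_g; rewrite /puncture_side mdegD mdegMn mdeg1; lia.
have dn : downward n.
  by move: side_g; rewrite /downward /puncture_side En mdegD mdegMn mdeg1; lia.
have nT : n \notin T.
  apply/negP => /regJ; apply; apply: monomial_ideal_mul (proj1 min_g) => //.
  by rewrite En lem_addr.
have [|S maxS] := @exists_maximal_strip d T v (g v) [set n].
  exists [:: n]; split=> // [|t]; first by apply/setP => t; rewrite !inE.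
  by rewrite inE => /eqP->; rewrite En mnmDE mulmnE mnm1E (negPf wv) addn0.
rewrite sub1set => nS.
exists (T :|: (S :\ raise w n)), J, v, g, S, (raise w n); split=> //.
  by split=> //; exists n.
by rewrite (strip_raise closedT maxS) // raise_up.
Qed.

(** Each step keeps the region closed and shrinks its complement, so stepping must end, and it can
    end only at unit punctures. *)
Lemma exists_reduction T : triangle_closed T ->
  exists That, reduction_to_unit_punctures K T That.
Proof.
elim: {T}#|~: T|.+1 {-2}T (ltnSn #|~: T|) => // k IHk T le_k closedT.
case: (only_unit_or_step closedT) => [unitT|[T1 step]].
  by exists T; split=> //; apply: rt1n_refl.
have [closedT1 lt1 _] := reduction_step_props step.
have [That [red unitT]] := IHk T1 (leq_trans lt1 le_k) closedT1.
by exists That; split=> //; apply: rt1n_trans step red.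
Qed.

(** The equivalence holds for an arbitrary chain of steps, which is why some reduction may be
    replaced by any. *)
Lemma reduction_maximal_rank T That : reduction_to_unit_punctures K T That ->
  Z_maximal_rank K T <-> Z_maximal_rank K That.
Proof.
case=> red _; elim: {T That}red => // T T1 That step _ IH.
by have [_ _ stepE] := reduction_step_props step; rewrite stepE.
Qed.

End Reduction.

Theorem proposition11p5 (K : fieldType) (d : nat) (d_ge1 : (1 <= d)%N)
    (T : {set unit_triangle d})
    (T_triangular : triangular_region K T)
    (T_proper : T \proper [set: unit_triangle d]) :
  (exists That, reduction_to_unit_punctures K T That) /\
  (Z_maximal_rank K T <->
     exists That, reduction_to_unit_punctures K T That /\ Z_maximal_rank K That) /\
  (Z_maximal_rank K T <->
     forall That, reduction_to_unit_punctures K T That -> Z_maximal_rank K That).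
Proof.
have [That red] : exists That, reduction_to_unit_punctures K T That.
  case: T_triangular => I monI regI.
  exact: exists_reduction (region_closed monI regI).
split; first by exists That.
split; split.
- by move=> rkT; exists That; split=> //; apply/(reduction_maximal_rank red).
- by case=> T' [red' rkT']; apply/(reduction_maximal_rank red').
- by move=> rkT T' red'; apply/(reduction_maximal_rank red').
- by move/(_ _ red) => rkT; apply/(reduction_maximal_rank red).
Qed.
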